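(* Any misaligned $r$-round (possibly randomized) protocol solving $\mathsf{BMHPC}_{m,r}$ correctly with constant probability requires $\Omega(m^2)$ bits of communication.
   Context: Let $\mathcal X=\{x_1,\dots,x_m\}$ and $\mathcal Y=\{y_1,\dots,y_m\}$ be disjoint universes. In $\mathsf{BMHPC}_{m,r}$ (Boolean Multilayer Hidden Pointer Chasing) there are four players $P_A,P_B,P_C,P_D$. For each layer $i\in[r]$ and each $x\in\mathcal X$, $P_A$ holds $A^i_x\subseteq\mathcal Y$ and $P_B$ holds $B^i_x\subseteq\mathcal Y$ with the promise $|A^i_x\cap B^i_x|=1$; write $A^i_x\cap B^i_x=\{t^i_x\}$ and $f^i_{AB}(x)=t^i_x$. For each $i\in[r]$ and $y\in\mathcal Y$, $P_C$ holds $C^i_y\subseteq\mathcal X$ and $P_D$ holds $D^i_y\subseteq\mathcal X$ with $|C^i_y\cap D^i_y|=1$; write $C^i_y\cap D^i_y=\{t^i_y\}$ and $f^i_{CD}(y)=t^i_y$. Define pointers $z_0=x_1$, $z_1=f^1_{AB}(z_0)$, $z_2=f^2_{CD}(z_1)$, $z_3=f^3_{AB}(z_2)$, and so on (alternating, using layer $j$ for $z_j$). The goal is to output $b(z_r)=i \bmod 2$, where $i$ is the index with $z_r=x_i$ (if $r$ even) or $z_r=y_i$ (if $r$ odd). An $r$-round protocol organizes communication into rounds $1,\dots,r$: one pair ($\{P_A,P_B\}$ or $\{P_C,P_D\}$) communicates among themselves in odd rounds and the other pair in even rounds; each round ends with the speaking pair sending a message to the other pair. The protocol is misaligned if $P_C,P_D$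 speak in the odd rounds and $P_A,P_B$ in the even rounds. *)

(* Defs.v *)
From HB Require Import structures.
From mathcomp Require Import all_boot all_order all_algebra.
From mathcomp Require Import all_classical all_reals all_analysis.

Set Implicit Arguments.
Unset Strict Implicit.
Unset Printing Implicit Defensive.

(** Boolean Multilayer Hidden Pointer Chasing. *)

Inductive team := AB | CD.
Inductive seat := First | Second.

Definition other (t : team) : team := if t is AB then CD else AB.

(** Both universes are indexed by ['I_m], the ordinal [i] standing for
    [x_(i+1)] or [y_(i+1)]; which one is meant is fixed by the team (AB maps X
    to Y, CD maps Y to X).  Layer [j] of the problem is the ordinal [j-1]. *)
Definition input (m r : nat) := {ffun 'I_r * 'I_m -> {set 'I_m}}.

Record instance (m r : nat) := Instance {
  inA : input m r; inB : input m r; inC : input m r; inD : input m r }.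

Definition held m r (x : instance m r) (t : team) (s : seat) : input m r :=
  match t, s with
  | AB, First => inA x | AB, Second => inB x
  | CD, First => inC x | CD, Second => inD x
  end.

Definition common m r (x : instance m r) (t : team) (j : 'I_r) (u : 'I_m) :
    {set 'I_m} :=
  held x t First (j, u) :&: held x t Second (j, u).

Definition promise m r (x : instance m r) : Prop :=
  forall t j u, #|common x t j u| = 1%N.

(** [pointer x k] is [z_k].  The value [None] only occurs when [m = 0], when
    [k > r], or when the promise is violated. *)
Fixpoint pointer m r (x : instance m r) (k : nat) : option 'I_m :=
  if k is k'.+1 then
    if (insub k' : option 'I_r, pointer x k') is (Some j, Some u) then
      unset1 (common x (if odd k' then CD else AB) j u)
    else None
  else insub 0%N.

(** The successor accounts for the indices of [X] and [Y] starting at 1. *)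
Definition BMHPC m r (x : instance m r) : option bool :=
  omap (fun z : 'I_m => odd z.+1) (pointer x r).

(** Protocols. *)

Definition bits := seq bool.

(** One round, as played by the speaking pair: a finite two-party protocol tree
    whose bits are seen only inside the pair ([Speak]), closed by a message of
    one of the two players to the other pair ([Send]). *)
Inductive round (I : Type) :=
  | Speak of seat & (I -> bool) & (bool -> round I)
  | Send of seat & (I -> bits).

(** The conversation inside the pair, and the message closing the round. *)
Fixpoint play (I : Type) (c : round I) (x : seat -> I) : bits * bits :=
  match c with
  | Speak s f next =>
      let b := f (x s) in let: (talk, w) := play (next b) x in (b :: talk, w)
  | Send s f => ([::], f (x s))
  end.

(** For each completed round: speaking team, conversation, message. *)
Definition history := seq (team * bits * bits).

Definition messages (h : history) : seq bits := [seq e.2 | e <- h].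

(** A pair sees all messages, and the conversations of its own rounds. *)
Definition view (t : team) (h : history) : seq (bits * bits) :=
  [seq (match t, e.1.1 with
        | AB, AB | CD, CD => e.1.2
        | _, _ => [::]
        end, e.2) | e <- h].

(** The number of the current round is known from the size of the view.  The
    output is read off the messages exchanged between the pairs. *)
Record strategy (m r : nat) := Strategy {
  opening : team;
  plan : team -> seq (bits * bits) -> round (input m r);
  answer : seq bits -> bool }.

Definition run_round m r (s : strategy m r) (x : instance m r) (h : history) :
    history :=
  let t := if odd (size h) then other (opening s) else opening s in
  let: (talk, w) := play (plan s t (view t h)) (held x t) in
  rcons h (t, talk, w).

Definition run m r (s : strategy m r) (x : instance m r) : history :=
  iter r (run_round s x) [::].

Definition output m r (s : strategy m r) (x : instance m r) : bool :=
  answer s (messages (run s x)).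

Definition cost m r (s : strategy m r) (x : instance m r) : nat :=
  \sum_(e <- run s x) (size e.1.2 + size e.2).

(** Given the earlier messages, the possible next messages form a prefix-free
    set, as in a protocol tree.  Otherwise the length of a message would carry
    information for free; over many rounds this is not a constant factor. *)
Definition self_delimiting m r (s : strategy m r) : Prop :=
  forall (x x' : instance m r) (k : nat), promise x -> promise x' ->
    let M := messages (run s x) in let M' := messages (run s x') in
    take k M = take k M' ->
    prefix (nth [::] M k) (nth [::] M' k) -> nth [::] M k = nth [::] M' k.

Record protocol (m r : nat) := Protocol {
  strat :> strategy m r;
  strat_self_delimiting : self_delimiting strat }.

Definition misaligned m r (p : protocol m r) : Prop := opening p = CD.

(** A randomized protocol is a family of protocols indexed by the outcome of
    (public) coins of arbitrary distribution [P]. *)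

Local Open Scope classical_set_scope.

Definition solves (R : realType) d (T : measurableType d) (P : probability T R)
    m r (p : T -> protocol m r) (q : R) : Prop :=
  forall x : instance m r, promise x ->
    let correct := [set w | BMHPC x = Some (output (p w) x)] in
    measurable correct /\ (q%:E <= P correct)%E.

Definition cost_at_most (T : Type) m r (p : T -> protocol m r) (n : nat) :
    Prop :=
  forall (w : T) (x : instance m r), promise x -> (cost (p w) x <= n)%N.

(* Main.v *)
(** The hard inputs are independent over all slots (layer, element): a uniform
    common element, and every other element is offered to one random seat, which
    takes it with probability 1/2.

    Before the team owning layer k learns z_(k-1), it can only have prepared all
    of f^k at once.  Given the transcript and the earlier pointers the two teams
    are independent, so z_k is as far from uniform as f^k(u) for an average u, up
    to the deviation of z_(k-1) itself.  A one-sided truncated chi-square measures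
    deviations so that this recursion is additive with coefficient 1; hence r does
    not enter.

    The average deviation of f^k(u) is bounded by Hellinger distances between the
    transcript laws for two values of the common element.  Cut-and-paste for
    rectangles reduces these to the influence of single coin flips on the
    transcript, and the level-one inequality bounds the sum of all influences by a
    multiple of the logarithm of the number of transcripts, hence of the cost n.
    Summing over k, the deviation of z_r is O(n / m^2). *)

Require Import Defs.
From HB Require Import structures.
From mathcomp Require Import all_boot all_order all_algebra.
From mathcomp Require Import perm ring lra zify.
From mathcomp Require Import all_classical all_reals all_analysis measurable_realfun.

Set Implicit Arguments.
Unset Strict Implicit.
Unset Printing Implicit Defensive.

Import Order.TTheory GRing.Theory Num.Theory.
Local Open Scope ring_scope.

(** * Squared Hellinger distances between nonnegative weights, and a truncated chi-square *)

Section Hellinger.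
Variable R : rcfType.
Implicit Types p q s : R.

Definition hel p q : R := (Num.sqrt p - Num.sqrt q) ^+ 2.

Lemma hel_ge0 p q : 0 <= hel p q.
Proof. exact: sqr_ge0. Qed.

Lemma helC p q : hel p q = hel q p.
Proof. by rewrite /hel -sqrrN opprB. Qed.

Lemma hel00 : hel 0 0 = 0.
Proof. by rewrite /hel subrr expr0n. Qed.

Lemma helxx p : hel p p = 0.
Proof. by rewrite /hel subrr expr0n. Qed.

Lemma helE p q : 0 <= p -> 0 <= q -> hel p q = p + q - 2 * Num.sqrt (p * q).
Proof.
move=> p0 q0; rewrite /hel sqrrB !sqr_sqrtr // sqrtrM //; ring.
Qed.

Lemma hel_scale a p q : 0 <= a -> hel (a * p) (a * q) = a * hel p q.
Proof.
move=> a0; rewrite /hel !sqrtrM // -mulrBr exprMn sqr_sqrtr //.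
Qed.

Lemma hel_triangle p q s : hel p q <= 2 * hel p s + 2 * hel q s.
Proof.
rewrite /hel; move: (Num.sqrt p) (Num.sqrt q) (Num.sqrt s) => x y z.
have := sqr_ge0 (x + y - 2 * z); nra.
Qed.

(** Cauchy-Schwarz makes the geometric mean superadditive. Together with [hel_scale] this is the
    joint convexity of [hel]. *)
Lemma helD p1 q1 p2 q2 : 0 <= p1 -> 0 <= q1 -> 0 <= p2 -> 0 <= q2 ->
  hel (p1 + p2) (q1 + q2) <= hel p1 q1 + hel p2 q2.
Proof.
move=> p10 q10 p20 q20; rewrite !helE ?addr_ge0 //.
suff : Num.sqrt (p1 * q1) + Num.sqrt (p2 * q2) <= Num.sqrt ((p1 + p2) * (q1 + q2)).
  by move=> H; lra.
rewrite -(@ler_pXn2r _ 2) ?nnegrE ?addr_ge0 ?sqrtr_ge0 //.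
rewrite sqr_sqrtr; last by rewrite mulr_ge0 ?addr_ge0.
rewrite !sqrtrM //.
set a := Num.sqrt p1; set b := Num.sqrt q1; set c := Num.sqrt p2; set d := Num.sqrt q2.
have -> : p1 = a ^+ 2 by rewrite sqr_sqrtr.
have -> : q1 = b ^+ 2 by rewrite sqr_sqrtr.
have -> : p2 = c ^+ 2 by rewrite sqr_sqrtr.
have -> : q2 = d ^+ 2 by rewrite sqr_sqrtr.
have := sqr_ge0 (a * d - c * b); nra.
Qed.

Lemma hel_sum (I : Type) (r : seq I) (P : pred I) (p q : I -> R) :
  (forall i, 0 <= p i) -> (forall i, 0 <= q i) ->
  hel (\sum_(i <- r | P i) p i) (\sum_(i <- r | P i) q i) <=
  \sum_(i <- r | P i) hel (p i) (q i).
Proof.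
move=> p0 q0; elim: r => [|i r IH]; first by rewrite !big_nil hel00.
rewrite !big_cons; case: (P i) => //.
apply: le_trans (helD _ _ _ _) _; rewrite ?sumr_ge0 //.
by rewrite lerD2l.
Qed.

(** Holds since [(sqrt p + sqrt q) ^+ 2] is at least [p + q]. The right side is the shape of the
    summands of [influence]. *)
Lemma hel_le_triangular p q : 0 <= p -> 0 <= q ->
  hel p q <= (p - q) ^+ 2 / (p + q).
Proof.
move=> p0 q0; have [pq0|n0] := eqVneq (p + q) 0.
  have [-> ->] : p = 0 /\ q = 0 by split; lra.
  by rewrite hel00 mulr_ge0 ?sqr_ge0 // invr_ge0 addr0.
rewrite ler_pdivlMr; last by rewrite lt0r n0 addr_ge0.
rewrite /hel; set a := Num.sqrt p; set b := Num.sqrt q.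
have -> : p = a ^+ 2 by rewrite sqr_sqrtr.
have -> : q = b ^+ 2 by rewrite sqr_sqrtr.
have -> : (a ^+ 2 - b ^+ 2) ^+ 2 = (a - b) ^+ 2 * (a + b) ^+ 2 by ring.
apply: ler_wpM2l; first exact: sqr_ge0.
have : 0 <= a * b by rewrite mulr_ge0 ?sqrtr_ge0.
by move=> ?; lra.
Qed.

(** For equal totals the distance depends only on the sum of the square roots of the pointwise
    products. *)
Lemma hel_cut_paste (E : finType) (a b b' s : E -> R) (T : R) :
  (forall x, 0 <= a x) -> (forall x, 0 <= b x) ->
  (forall x, 0 <= b' x) -> (forall x, 0 <= s x) ->
  \sum_x a x = T -> \sum_x b x = T -> \sum_x b' x = T -> \sum_x s x = T ->
  (forall x, a x * s x = b x * b' x) ->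
  \sum_x hel (a x) (s x) = \sum_x hel (b x) (b' x).
Proof.
move=> a0 b0 b'0 s0 Ta Tb Tb' Ts cp.
rewrite (eq_bigr (fun x => a x + s x - 2 * Num.sqrt (b x * b' x))); last first.
  by move=> x _; rewrite helE // cp.
rewrite [RHS](eq_bigr (fun x => b x + b' x - 2 * Num.sqrt (b x * b' x))); last first.
  by move=> x _; rewrite helE.
by rewrite !big_split /= Ta Tb Tb' Ts.
Qed.

(* [psi <= p] and [p <= 2 q + psi] hold with coefficient 1 on [psi], so deviations
   add up over the rounds; [psi] is still quadratic near [p = q]. *)
Definition psi p q : R := Num.max (p - q) 0 ^+ 2 / p.

Lemma psi_ge0 p q : 0 <= p -> 0 <= psi p q.
Proof. by move=> p0; rewrite divr_ge0 ?sqr_ge0. Qed.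

Lemma psi_le p q : 0 <= p -> 0 <= q -> psi p q <= p.
Proof.
move=> p0 q0; rewrite /psi; have [->|n0] := eqVneq p 0; first by rewrite invr0 mulr0.
have pp : 0 < p by rewrite lt0r n0.
rewrite ler_pdivrMr //; rewrite /Num.max; case: ifP => [_|/negbT]; first by nra.
by rewrite -leNgt => ?; nra.
Qed.

Lemma psi_ge p q : 0 <= p -> 0 <= q -> p <= 2 * q + psi p q.
Proof.
move=> p0 q0; rewrite /psi; have [->|n0] := eqVneq p 0.
  by rewrite invr0 mulr0; lra.
have pp : 0 < p by rewrite lt0r n0.
rewrite -lerBlDl ler_pdivlMr // /Num.max; case: ifP => [|/negbT]; first by nra.
by rewrite -leNgt => ?; nra.
Qed.

Lemma psi_le_hel p q : 0 <= p -> 0 <= q -> psi p q <= 4 * hel p q.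
Proof.
move=> p0 q0; rewrite /psi; have [->|n0] := eqVneq p 0.
  by rewrite invr0 mulr0 mulr_ge0 ?hel_ge0.
have pp : 0 < p by rewrite lt0r n0.
rewrite ler_pdivrMr // /Num.max; case: ifP => [_|/negbT].
  by rewrite expr0n /= mulr_ge0 // mulr_ge0 ?hel_ge0.
rewrite -leNgt subr_ge0 => qp; rewrite /hel.
have ab : Num.sqrt q <= Num.sqrt p by rewrite ler_sqrt.
move: ab; set a := Num.sqrt p; set b := Num.sqrt q => ab.
have b0 : 0 <= b by rewrite sqrtr_ge0.
have -> : p = a ^+ 2 by rewrite sqr_sqrtr.
have -> : q = b ^+ 2 by rewrite sqr_sqrtr.
have -> : (a ^+ 2 - b ^+ 2) ^+ 2 = (a - b) ^+ 2 * (a + b) ^+ 2 by ring.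
have -> : 4 * (a - b) ^+ 2 * a ^+ 2 = (a - b) ^+ 2 * (4 * a ^+ 2) by ring.
by apply: ler_wpM2l; [exact: sqr_ge0|nra].
Qed.

(** AM-GM splits [p - q] into [eps * p] and [(p - q) ^+ 2 / (4 * eps * p)]. *)
Lemma le_eps_psi eps p q : 0 < eps -> 0 <= p -> 0 <= q ->
  p <= q + eps * p + (4 * eps)^-1 * psi p q.
Proof.
move=> e0 p0 q0; rewrite /psi; have [->|n0] := eqVneq p 0.
  by rewrite invr0 !mulr0 !addr0.
have pp : 0 < p by rewrite lt0r n0.
have -> : (4 * eps)^-1 * (Num.max (p - q) 0 ^+ 2 / p) =
   Num.max (p - q) 0 ^+ 2 / (4 * eps * p).
  by field; rewrite n0 gt_eqF.
rewrite -lerBlDl ler_pdivlMr; last by rewrite !mulr_gt0.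
rewrite /Num.max; case: ifP => [qp|/negbT].
  rewrite expr0n /=; have : p - (q + eps * p) <= 0 by nra.
  by move=> ?; rewrite mulr_le0_ge0 // !mulr_ge0 // ltW.
rewrite -leNgt => _; rewrite -subr_ge0.
rewrite (_ : _ - _ = (p - q - 2 * eps * p) ^+ 2) ?sqr_ge0 //; ring.
Qed.

End Hellinger.

(** * Conditional laws on a finite uniform space and their deviation from uniform *)

Section Conditional.
Variables (R : rcfType) (W : finType).

Definition fibsize (E : eqType) (G : W -> E) (w : W) : R :=
  \sum_(w' | G w' == G w) 1.

(** Conditional expectation given [G] under the uniform law on [W]; [post] is the resulting
    posterior probability. *)
Definition cavg (E : eqType) (G : W -> E) (f : W -> R) (w : W) : R :=
  (\sum_(w' | G w' == G w) f w') / fibsize G w.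

Definition post (E : eqType) (G : W -> E) (Z : eqType) (Y : W -> Z) (z : Z) : W -> R :=
  cavg G (fun w => (Y w == z)%:R).

Lemma fibsize_gt0 (E : eqType) (G : W -> E) w : 0 < fibsize G w.
Proof.
rewrite /fibsize (bigD1 w) //= ltr_pwDl //; exact: sumr_ge0.
Qed.

Lemma fibsize_neq0 (E : eqType) (G : W -> E) w : fibsize G w != 0.
Proof. by rewrite gt_eqF ?fibsize_gt0. Qed.

Lemma sum_fib_const (E : eqType) (G : W -> E) w (x : R) :
  \sum_(w' | G w' == G w) x = fibsize G w * x.
Proof. by rewrite /fibsize mulr_suml; under [RHS]eq_bigr do rewrite mul1r. Qed.

Lemma fibsize_eq (E : eqType) (G : W -> E) w w' : G w = G w' -> fibsize G w = fibsize G w'.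
Proof. by rewrite /fibsize => ->. Qed.

Lemma cavg_eq (E : eqType) (G : W -> E) f w w' : G w = G w' -> cavg G f w = cavg G f w'.
Proof. by rewrite /cavg /fibsize => ->. Qed.

Lemma cavg_tower (E : eqType) (G : W -> E) (f h : W -> R) :
  (forall w w', G w = G w' -> h w = h w') ->
  \sum_w f w * h w = \sum_w cavg G f w * h w.
Proof.
move=> hG; rewrite /cavg.
under [RHS]eq_bigr do rewrite -mulrA mulr_suml big_mkcond /=.
rewrite exchange_big /=; apply: eq_bigr => w _.
rewrite -big_mkcond /=.
rewrite (eq_bigr (fun=> f w * ((fibsize G w)^-1 * h w))); last first.
  by move=> w' /eqP e; rewrite (fibsize_eq (esym e)) (hG _ _ (esym e)).
rewrite (eq_bigl (fun w' => G w' == G w)) => [|w']; last by rewrite eq_sym.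
by rewrite sum_fib_const mulrCA mulVKf ?fibsize_neq0.
Qed.

Lemma post_ge0 (E : eqType) (G : W -> E) (Z : eqType) (Y : W -> Z) z w : 0 <= post G Y z w.
Proof. by rewrite divr_ge0 ?(ltW (fibsize_gt0 _ _)) ?sumr_ge0. Qed.

Lemma post_sum (E : eqType) (G : W -> E) (Z : finType) (Y : W -> Z) w :
  \sum_z post G Y z w = 1.
Proof.
rewrite /post /cavg -mulr_suml exchange_big /=.
rewrite (eq_bigr (fun=> 1)); first by rewrite divff // gt_eqF ?fibsize_gt0.
move=> w' _; rewrite (bigD1 (Y w')) //= eqxx big1 ?addr0 // => z.
by rewrite eq_sym => /negbTE ->.
Qed.

Lemma cavg_coarsen (E E' : eqType) (G : W -> E) (G' : W -> E') f w :
  (forall w w', G' w = G' w' -> G w = G w') ->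
  cavg G f w = cavg G (cavg G' f) w.
Proof.
move=> ref; rewrite /cavg; congr (_ / _).
have ind g : \sum_(w' | G w' == G w) g w' = \sum_w' g w' * (G w' == G w)%:R.
  by rewrite big_mkcond; apply: eq_bigr => w' _; case: ifP; rewrite ?mulr1 ?mulr0.
by rewrite !ind; apply: (@cavg_tower _ G') => w1 w2 /ref ->.
Qed.

(** Data processing: the posterior given [G] is the average over a fibre of the posteriors given the
    finer [G'], and [hel] is jointly convex. *)
Lemma sum_hel_coarsen (E E' : eqType) (G : W -> E) (G' : W -> E') (Z : eqType) (Y : W -> Z) z z' :
  (forall w w', G' w = G' w' -> G w = G w') ->
  \sum_w hel (post G Y z w) (post G Y z' w) <=
  \sum_w hel (post G' Y z w) (post G' Y z' w).
Proof.
move=> ref.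
pose h w := hel (post G' Y z w) (post G' Y z' w).
have -> : \sum_w h w = \sum_w cavg G h w.
  have := @cavg_tower _ G h (fun=> 1) (fun _ _ _ => erefl).
  by under eq_bigr do rewrite mulr1; under [RHS]eq_bigr do rewrite mulr1.
apply: ler_sum => w _.
rewrite /post (cavg_coarsen _ _ ref) [X in hel _ X](cavg_coarsen _ _ ref).
rewrite {1 3 5}/cavg ![_ / fibsize G w]mulrC hel_scale ?invr_ge0 ?(ltW (fibsize_gt0 _ _)) //.
rewrite ler_wpM2l ?invr_ge0 ?(ltW (fibsize_gt0 _ _)) //.
by apply: hel_sum => w'; exact: post_ge0.
Qed.

(** Each nonempty fibre contributes its value once. Empty fibres are absent on the left, so [F] has
    to vanish there. *)
Lemma sum_fibres (E : finType) (G : W -> E) (F : E -> R) :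
  (forall g, (forall w, G w != g) -> F g = 0) ->
  \sum_w F (G w) / fibsize G w = \sum_g F g.
Proof.
move=> F0; rewrite (partition_big G xpredT) //=; apply: eq_bigr => g _.
have [w /eqP gw|ng] := pickP (fun w => G w == g); last first.
  by rewrite big_pred0 // F0 // => w; rewrite ng.
rewrite (eq_bigr (fun=> 1 * (F g / fibsize G w))); last first.
  by move=> w' /eqP e; rewrite mul1r e (@fibsize_eq _ G w' w) // e.
rewrite -mulr_suml -{1}gw -/(fibsize G w) mulrCA divff ?mulr1 //.
by rewrite gt_eqF ?fibsize_gt0.
Qed.

Variable m : nat.
Hypothesis m_gt0 : (0 < m)%N.

Let mR_gt0 : 0 < m%:R :> R. Proof. by rewrite ltr0n. Qed.

(* Distance to uniform of the law of [Y] given [G], at the point [w]. *)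
Definition lawdev (E : eqType) (G : W -> E) (Y : W -> 'I_m) (w : W) : R :=
  \sum_z psi (post G Y z w) m%:R^-1.

(** A sum, not an average, over [W]: bounds on it carry the factor [#|W|]. *)
Definition dev (E : eqType) (G : W -> E) (Y : W -> 'I_m) : R := \sum_w lawdev G Y w.

Lemma lawdev_ge0 (E : eqType) (G : W -> E) Y w : 0 <= lawdev G Y w.
Proof. by apply: sumr_ge0 => z _; rewrite psi_ge0 ?post_ge0. Qed.

Lemma lawdev_le1 (E : eqType) (G : W -> E) Y w : lawdev G Y w <= 1.
Proof.
rewrite -(post_sum G Y w); apply: ler_sum => z _.
by rewrite psi_le ?post_ge0 // invr_ge0 ltW.
Qed.

Lemma lawdev_eq (E : eqType) (G : W -> E) Y w w' : G w = G w' -> lawdev G Y w = lawdev G Y w'.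
Proof. by move=> e; apply: eq_bigr => z _; rewrite /post (cavg_eq _ e). Qed.

Section Step.
Variables (E E' : eqType) (G : W -> E) (G' : W -> E') (U : W -> 'I_m) (F : 'I_m -> W -> 'I_m).
Hypothesis indep : forall w z,
  post G' (fun w' => F (U w') w') z w = post G (F (U w)) z w.

(** [lawdev G (F u)] is constant on the fibres of [G], so the indicator of [U w = u] can be replaced
    by its posterior. *)
Lemma dev_step_eq : dev G' (fun w => F (U w) w) =
  \sum_w \sum_u post G U u w * lawdev G (F u) w.
Proof.
rewrite exchange_big /= /dev.
under [RHS]eq_bigr => u _.
  rewrite -cavg_tower; last by move=> w w'; exact: lawdev_eq.
  over.
rewrite [RHS]exchange_big /=; apply: eq_bigr => w _.
rewrite (bigD1 (U w)) //= eqxx mul1r big1 ?addr0; last first.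
  by move=> u; rewrite eq_sym => /negbTE ->; rewrite mul0r.
by apply: eq_bigr => z _; rewrite indep.
Qed.

(** Bounds the posterior of [U] by 1. Meant for the first step, where the pointer is fixed and thus
    far from uniform. *)
Lemma dev_step_init : dev G' (fun w => F (U w) w) <= \sum_u dev G (F u).
Proof.
rewrite dev_step_eq exchange_big /=; apply: ler_sum => u _; apply: ler_sum => w _.
rewrite ler_piMl ?lawdev_ge0 // -(post_sum G U w) (bigD1 u) //= lerDl.
by apply: sumr_ge0 => *; exact: post_ge0.
Qed.

(** By [psi_ge] the posterior of [u] is at most [2 / m] plus its own [psi]. The first part averages
    over [u]; in the second, [lawdev] is at most 1, and what remains sums to [dev G U]. *)
Lemma dev_step : dev G' (fun w => F (U w) w) <=
  dev G U + 2 / m%:R * \sum_u dev G (F u).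
Proof.
rewrite dev_step_eq /dev mulr_sumr.
under [X in _ + X]eq_bigr do rewrite mulr_sumr.
rewrite [X in _ + X]exchange_big /= -big_split /=; apply: ler_sum => w _.
rewrite /lawdev -big_split /=; apply: ler_sum => u _.
rewrite -/(lawdev G (F u) w).
have i0 : 0 <= m%:R^-1 :> R by rewrite invr_ge0 ltW.
apply: le_trans (_ : (2 * m%:R^-1 + psi (post G U u w) m%:R^-1) * lawdev G (F u) w <= _).
  by rewrite ler_wpM2r ?lawdev_ge0 // psi_ge ?post_ge0.
rewrite mulrDl [leRHS]addrC; apply: lerD; first by [].
rewrite ler_piMr ?lawdev_le1 // psi_ge0 // post_ge0 //.
Qed.

End Step.

(** The uniform weight is the average over [e'] of the posteriors of [e'], so convexity of [hel]
    reduces to pairwise distances. *)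
Lemma dev_le_hel (E : eqType) (G : W -> E) (Y : W -> 'I_m) :
  dev G Y <= 4 / m%:R * \sum_e \sum_e' \sum_w hel (post G Y e w) (post G Y e' w).
Proof.
rewrite mulr_sumr /dev exchange_big /=; apply: ler_sum => e _.
rewrite exchange_big /= mulr_sumr; apply: ler_sum => w _.
have i0 : 0 <= m%:R^-1 :> R by rewrite invr_ge0 ltW.
apply: le_trans (psi_le_hel _ _) _; rewrite ?post_ge0 //.
rewrite -mulrA ler_wpM2l // mulr_sumr.
have -> : hel (post G Y e w) m%:R^-1 =
    hel (\sum_(e' < m) m%:R^-1 * post G Y e w) (\sum_(e' < m) m%:R^-1 * post G Y e' w).
  congr hel; last by rewrite -mulr_sumr post_sum mulr1.
  by rewrite sumr_const card_ord -mulrnAl -mulr_natr mulVf ?mul1r // gt_eqF.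
apply: le_trans (hel_sum _ _ _ _) _; try by move=> *; rewrite mulr_ge0 ?post_ge0.
by apply: ler_sum => e' _; rewrite hel_scale.
Qed.

(** Here [o w] is the set of values for which the guess is right. Since [G] determines it, the
    indicator of success becomes a sum of posteriors, and [le_eps_psi] compares each with
    [1 / m]. *)
Lemma guess_le (E : eqType) (G : W -> E) (Y : W -> 'I_m) (o : W -> pred 'I_m)
  (N eps : R) : 0 < eps ->
  (forall w w', G w = G w' -> o w = o w') ->
  (forall w, \sum_(z | o w z) 1 <= N) ->
  \sum_w (o w (Y w))%:R <= #|W|%:R * (N / m%:R + eps) + (4 * eps)^-1 * dev G Y.
Proof.
move=> e0 oG oN.
have i0 : 0 <= m%:R^-1 :> R by rewrite invr_ge0 ltW.
have -> : \sum_w (o w (Y w))%:R = \sum_w \sum_(z | o w z) post G Y z w.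
  under [RHS]eq_bigr do rewrite big_mkcond /=.
  rewrite exchange_big /=.
  rewrite [RHS](eq_bigr (fun z => \sum_w (Y w == z)%:R * (o w z)%:R)); last first.
    move=> z _; rewrite [RHS](@cavg_tower _ G); last by move=> w w' /oG ->.
    by apply: eq_bigr => w _; case: (o w z); rewrite ?mulr1 ?mulr0.
  rewrite exchange_big /=; apply: eq_bigr => w _.
  rewrite (bigD1 (Y w)) //= eqxx mul1r big1 ?addr0 // => z.
  by rewrite eq_sym => /negbTE ->; rewrite mul0r.
rewrite /dev mulr_sumr -sum1_card natr_sum mulr_suml -big_split /=.
apply: ler_sum => w _; rewrite mul1r.
apply: le_trans (_ : \sum_(z | o w z) (m%:R^-1 + (eps * post G Y z w +
    (4 * eps)^-1 * psi (post G Y z w) m%:R^-1)) <= _).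
  by apply: ler_sum => z _; rewrite addrA le_eps_psi ?post_ge0.
rewrite big_split /= -addrA; apply: lerD.
  rewrite (eq_bigr (fun=> 1 * m%:R^-1)) => [|*]; last by rewrite mul1r.
  by rewrite -mulr_suml ler_wpM2r.
have -> : eps + (4 * eps)^-1 * lawdev G Y w = \sum_z (eps * post G Y z w +
    (4 * eps)^-1 * psi (post G Y z w) m%:R^-1).
  by rewrite big_split -!mulr_sumr post_sum mulr1.
rewrite [leRHS](bigID (o w)) /= lerDl sumr_ge0 // => z _.
apply: addr_ge0; apply: mulr_ge0; rewrite ?psi_ge0 ?post_ge0 ?invr_ge0 //.
  exact: ltW.
by rewrite mulr_ge0 // ltW.
Qed.

End Conditional.

(** * The level-one inequality for functions on the Boolean cube *)

Section LevelOne.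
Variable R : realType.

(** Through [expR y <= (1 - y)^-1]: the product of [1 - y] and the right side is
    [1 + y ^+ 2 * (1 - 2 * y)]. *)
Lemma expR_le_quad (y : R) : y <= 2^-1 -> expR y <= 1 + y + 2 * y ^+ 2.
Proof.
move=> y2; rewrite -[y in expR y]opprK expRN.
have h : 0 < 1 - y by lra.
have := expR_ge1Dx (- y) => e.
apply: (@le_trans _ _ (1 - y)^-1).
  by rewrite lef_pV2 ?posrE ?expR_gt0.
rewrite -[leLHS]mul1r ler_pdivrMr //; have := sqr_ge0 y; nra.
Qed.

Lemma cosh_le (y : R) : - 2^-1 <= y <= 2^-1 ->
  expR y + expR (- y) <= 2 * expR (2 * y ^+ 2).
Proof.
move=> /andP[y1 y2].
have := expR_le_quad y2.
have : - y <= 2^-1 by lra.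
move=> /expR_le_quad; rewrite sqrrN.
have := expR_ge1Dx (2 * y ^+ 2); lra.
Qed.

Variables (K E : finType) (h : {ffun K -> bool} -> E).

Definition count_at (k : K) (a : bool) (x : E) : R :=
  \sum_(c : {ffun K -> bool} | (c k == a) && (h c == x)) 1.

(** The second moment of the conditional mean of the sign of coin [k] given [h], times [2 ^ #|K|];
    see [influenceE]. *)
Definition influence (k : K) : R :=
  \sum_x (count_at k true x - count_at k false x) ^+ 2 /
         (count_at k true x + count_at k false x).

Let mass x : R := \sum_(c | h c == x) 1.
Let bias k x : R := (count_at k true x - count_at k false x) / mass x.
Let sg (b : bool) : R := if b then 1 else -1.

Lemma count_at_ge0 k a x : 0 <= count_at k a x.
Proof. exact: sumr_ge0. Qed.

Lemma count_atD k x : count_at k true x + count_at k false x = mass x.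
Proof.
rewrite /mass (bigID (fun c : {ffun K -> bool} => c k)) /= /count_at.
by congr (_ + _); apply: eq_bigl => c; rewrite andbC; case: (c k).
Qed.

Lemma influence_ge0 k : 0 <= influence k.
Proof.
by apply: sumr_ge0 => x _; rewrite divr_ge0 ?sqr_ge0 ?addr_ge0 ?count_at_ge0.
Qed.

Lemma influenceE k : influence k = \sum_x mass x * bias k x ^+ 2.
Proof.
apply: eq_bigr => x _; rewrite count_atD /bias.
have [->|n0] := eqVneq (mass x) 0; first by rewrite invr0 mulr0 mul0r.
by field.
Qed.

Lemma sum_sg x k : \sum_(c | h c == x) sg (c k) = mass x * bias k x.
Proof.
have [s0|n0] := eqVneq (mass x) 0.
  rewrite s0 mul0r big1 // => c hc; exfalso; move: s0.
  rewrite /mass (bigD1 c) //= => /eqP; rewrite gt_eqF //.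
  by rewrite ltr_pwDl // sumr_ge0.
rewrite /bias mulrCA divff // mulr1 (bigID (fun c : {ffun K -> bool} => c k)) /=.
rewrite /count_at -sumrN; congr (_ + _).
  by apply: eq_big => c; [rewrite andbC; case: (c k)|case/andP => _ ->].
by apply: eq_big => c; [rewrite andbC; case: (c k)|case/andP => _ /negbTE ->].
Qed.

Lemma bias_bound k x : -1 <= bias k x <= 1.
Proof.
rewrite /bias; have [->|n0] := eqVneq (mass x) 0; first by rewrite invr0 mulr0; lra.
have s0 : 0 < mass x by rewrite lt0r n0 sumr_ge0.
rewrite ler_pdivrMr // ler_pdivlMr // -(count_atD k x).
by have := count_at_ge0 k true x; have := count_at_ge0 k false x; lra.
Qed.

(* Exponential moment of the linear form with coefficients [bias k x / 4]:
   Jensen on the fibre of [x] against independence on the whole cube. *)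
Lemma mass_expR_le x :
  mass x * expR (\sum_k bias k x ^+ 2 / 8) <= 2 ^+ #|K|.
Proof.
pose b k := bias k x; pose L (c : {ffun K -> bool}) := \sum_k b k / 4 * sg (c k).
pose a := \sum_k b k ^+ 2 / 4.
have up : \sum_c expR (L c) <= 2 ^+ #|K| * expR (\sum_k b k ^+ 2 / 8).
  under eq_bigr do rewrite /L expR_sum.
  rewrite -(bigA_distr_bigA (fun k u => expR (b k / 4 * sg u))) /=.
  rewrite expR_sum -[2 ^+ _]prodr_const -big_split /=; apply: ler_prod => k _.
  rewrite big_bool /= /sg mulr1 mulrN1 addr_ge0 ?expR_ge0 //=.
  have -> : b k ^+ 2 / 8 = 2 * (b k / 4) ^+ 2 by field.
  by apply: cosh_le; have := bias_bound k x; rewrite /b; lra.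
have low : mass x * expR a <= \sum_c expR (L c).
  apply: (@le_trans _ _ (\sum_(c | h c == x) expR (L c))); last first.
    by rewrite [leRHS](bigID (fun c => h c == x)) /= lerDl sumr_ge0 // => *; exact: expR_ge0.
  have -> : mass x * expR a = \sum_(c | h c == x) expR a * (1 + (L c - a)).
    rewrite -mulr_sumr mulrC; congr (_ * _); rewrite big_split /= -/(mass x).
    rewrite big_split /= -[LHS]addr0; congr (_ + _).
    have -> : \sum_(c | h c == x) - a = mass x * - a.
      by rewrite /mass mulr_suml; under [RHS]eq_bigr do rewrite mul1r.
    rewrite /L exchange_big /=.
    under eq_bigr do rewrite -mulr_sumr sum_sg.
    rewrite mulrN /a mulr_sumr -sumrB big1 // => k _.
    by rewrite -/(b k); field.
  apply: ler_sum => c _; have -> : expR (L c) = expR a * expR (L c - a).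
    by rewrite -expRD; congr expR; ring.
  by rewrite ler_wpM2l ?expR_ge0 ?expR_ge1Dx.
have := le_trans low up.
have -> : a = \sum_k b k ^+ 2 / 8 + \sum_k b k ^+ 2 / 8.
  by rewrite -big_split /=; apply: eq_bigr => k _; field.
by rewrite expRD mulrA ler_pM2r ?expR_gt0.
Qed.

(** Summing [mass_expR_le] over at most [2 ^ n] values bounds the mean of [expR (Y x)] by [expR n].
    Jensen then bounds the mean of [Y], which is an eighth of the total influence up to
    normalisation. *)
Lemma sum_influence_le n : (#|[set h c | c in predT]| <= 2 ^ n)%N ->
  \sum_k influence k <= 8 * n%:R * 2 ^+ #|K|.
Proof.
move=> hn; pose Y x := \sum_k bias k x ^+ 2 / 8.
pose a : R := n%:R.
have szT : \sum_x mass x = 2 ^+ #|K|.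
  have := @partition_big R 0 +%R {ffun K -> bool} (index_enum _) E predT h predT (fun=> 1) (fun _ _ => erefl).
  by rewrite sumr_const card_ffun card_bool -[LHS]mulr_natr mul1r natrX => ->.
have up : \sum_x mass x * expR (Y x) <= 2 ^+ #|K| * expR a.
  rewrite (bigID (mem [set h c | c in predT])) /= [X in _ + X]big1 ?addr0; last first.
    move=> x /imsetP nx; rewrite /mass big_pred0 ?mul0r // => c.
    by apply/eqP => hc; apply: nx; exists c.
  apply: (@le_trans _ _ (\sum_(x in [set h c | c in predT]) 2 ^+ #|K|)).
    by apply: ler_sum => x _; exact: mass_expR_le.
  rewrite sumr_const -[leLHS]mulr_natr ler_wpM2l ?exprn_ge0 //.
  apply: (@le_trans _ _ (2 ^+ n)); first by rewrite -natrX ler_nat.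
  rewrite /a -[n%:R]mulr1 expRM_natl; apply: lerXn2r; rewrite ?nnegrE ?expR_ge0 //.
  by have := expR_ge1Dx (1 : R); lra.
(* Jensen by the tangent of [expR] at [a], so that no logarithm is taken. *)
have low : \sum_x mass x * (expR a * (1 + (Y x - a))) <= \sum_x mass x * expR (Y x).
  apply: ler_sum => x _; rewrite ler_wpM2l ?sumr_ge0 //.
  have -> : expR (Y x) = expR a * expR (Y x - a).
    by rewrite -expRD; congr expR; ring.
  by rewrite ler_wpM2l ?expR_ge0 ?expR_ge1Dx.
have := le_trans low up; under eq_bigr do rewrite mulrCA.
rewrite -mulr_sumr mulrC ler_pM2r ?expR_gt0 // => H.
have -> : \sum_k influence k = 8 * \sum_x mass x * Y x.
  under eq_bigr do rewrite influenceE.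
  rewrite exchange_big mulr_sumr; apply: eq_bigr => x _.
  by rewrite /Y -mulr_sumr -mulr_suml; field.
move: H; under eq_bigr do rewrite mulrDr mulr1 mulrBr.
rewrite big_split /= sumrB szT -mulr_suml szT /a; lra.
Qed.

End LevelOne.

(** A product of counts is a count of pairs, which the involution [sw] matches one to one. *)
Lemma count_swap (R : comPzSemiRingType) (T : finType) (sw : T * T -> T * T) (P Q P' Q' : pred T) :
  involutive sw ->
  (forall p, P' (sw p).1 && Q' (sw p).2 = P p.1 && Q p.2) ->
  (\sum_(x | P x) 1) * (\sum_(x | Q x) 1) =
  (\sum_(x | P' x) 1) * (\sum_(x | Q' x) 1) :> R.
Proof.
move=> swK PQ; rewrite !big_distrlr /= !pair_big /=.
rewrite [RHS](reindex_inj (inv_inj swK)) /=.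
by apply: eq_bigl => p; rewrite PQ.
Qed.

(** * How much a rectangular transcript reveals about a common element *)

Section Core.
Variables (R : realType) (I : finType) (m : nat) (E : finType).
Let K := (I * 'I_m)%type.
Let B := {ffun K -> bool}.
Let T := {ffun I -> 'I_m}.
Variable Pi : B -> B -> E.
Hypothesis rect : forall f g f' g', Pi f g = Pi f' g' -> Pi f g' = Pi f g.

Implicit Types (t : T) (o c : B) (k : K).

(* Element [k.2] of the universe in the set that seat [s] holds in slot [k.1]:
   [t] is the common element, [o] the seat allowed to own each other element,
   and [c] tells whether it does. *)
Definition seatset t o c (s : bool) : B :=
  [ffun k => (k.2 == t k.1) || ((o k == s) && c k)].

Definition force k (a : bool) (f : B) : B := [ffun k' => if k' == k then a else f k'].

Definition leaf t o c : E := Pi (seatset t o c false) (seatset t o c true).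

Definition leaf_count t o (x : E) : R := \sum_(c | leaf t o c == x) 1.

(* Forcing [k] into both sets breaks the promise, which is harmless: transcripts
   exist for all inputs, and only their number under the promise is bounded. *)
Definition forced t o k (a b : bool) (x : E) : R :=
  \sum_(c | Pi (force k a (seatset t o c false)) (force k b (seatset t o c true)) == x) 1.

Lemma forced_ge0 t o k a b x : 0 <= forced t o k a b x.
Proof. exact: sumr_ge0. Qed.

Lemma forced_total t o k a b : \sum_x forced t o k a b x = 2 ^+ #|{: K}|.
Proof.
rewrite /forced.
have := @partition_big R 0 +%R B (index_enum _) E predT
  (fun c => Pi (force k a (seatset t o c false)) (force k b (seatset t o c true)))
  predT (fun=> 1) (fun _ _ => erefl).
rewrite sumr_const => <-.
by rewrite card_ffun card_bool -[LHS]mulr_natr mul1r natrX.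
Qed.

(** Two coin vectors exchange the coins owned by seat [true]. Each seat's set then comes from a
    single vector, so by [rect] the transcript [x] survives the exchange. *)
Lemma cut_paste t o k x :
  forced t o k false false x * forced t o k true true x =
  forced t o k true false x * forced t o k false true x.
Proof.
rewrite [RHS]mulrC.
pose mixc (c c' : B) : B := [ffun k => if o k then c' k else c k].
have mixF c c' : seatset t o (mixc c c') false = seatset t o c false.
  by apply/ffunP => k'; rewrite !ffunE; case: (o k').
have mixT c c' : seatset t o (mixc c c') true = seatset t o c' true.
  by apply/ffunP => k'; rewrite !ffunE; case: (o k').
apply: (@count_swap _ _ (fun p => (mixc p.1 p.2, mixc p.2 p.1))).
  by move=> [c c']; congr pair; apply/ffunP => k'; rewrite !ffunE; case: (o k').
move=> [c c'] /=; rewrite !mixF !mixT.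
apply/andP/andP => -[/eqP e1 /eqP e2].
  have h := rect (etrans e1 (esym e2)); have h' := rect (etrans e2 (esym e1)).
  by rewrite h h' e1 e2.
have h := rect (etrans e1 (esym e2)); have h' := rect (etrans e2 (esym e1)).
by rewrite h h' e1 e2.
Qed.

Lemma forced_set_own t o k d a b x : forced t (force k d o) k a b x = forced t o k a b x.
Proof.
apply: eq_bigl => c; congr (Pi _ _ == x); apply/ffunP => k'; rewrite !ffunE;
by case: (k' == k).
Qed.

Lemma count_half (k : K) (a : bool) (P : pred B) : (forall c b, P (force k b c) = P c) ->
  \sum_(c | P c) 1 = 2 * \sum_(c : B | (c k == a) && P c) 1 :> R.
Proof.
move=> Pk; rewrite mulr_natl mulr2n (bigID (fun c : B => c k == a)) /=; congr (_ + _).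
  by apply: eq_bigl => c; rewrite andbC.
rewrite (reindex_inj (h := fun c : B => force k (~~ c k) c)) /=; last first.
  apply: (@inv_inj _ (fun c : B => force k (~~ c k) c)) => c; apply/ffunP => k'.
  by rewrite !ffunE eqxx; case: eqP => // ->; rewrite negbK.
apply: eq_bigl => c; rewrite Pk ffunE eqxx andbC.
by case: (c k); case: a.
Qed.

Section OneCoordinate.
Variables (t : T) (k : K).
Hypothesis kt : k.2 != t k.1.

Lemma leaf_force o c s a : c k = a ->
  seatset t o c s = force k ((o k == s) && a) (seatset t o c s).
Proof.
move=> ck; apply/ffunP => k'; rewrite !ffunE; case: (eqVneq k' k) => // ->.
by rewrite (negbTE kt) ck.
Qed.

Lemma forced_count o a x :
  forced t o k ((o k == false) && a) ((o k == true) && a) x =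
  2 * count_at R (leaf t o) k a x.
Proof.
rewrite /forced (@count_half k a) => [|c b].
  congr (2 * _); apply: eq_bigl => c; case: eqP => //= ck.
  by rewrite /leaf [in RHS](leaf_force o false ck) [in RHS](leaf_force o true ck).
congr (Pi _ _ == x); apply/ffunP => k'; rewrite !ffunE;
by case: (k' == k).
Qed.

(** Coin [k] is fair: [k] lies in neither set or in its owner's set, each with weight one half. *)
Lemma leaf_countE o x : leaf_count t o x =
  2^-1 * forced t o k false false x + 2^-1 * forced t o k (~~ o k) (o k) x.
Proof.
have := forced_count o false x; rewrite !andbF => ->.
have := forced_count o true x; rewrite !andbT.
have -> : (o k == false) = ~~ o k by case: (o k).
have -> : (o k == true) = o k by case: (o k).
move=> ->; rewrite /leaf_count -(@count_atD _ _ _ (leaf t o) k) addrC.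
by rewrite !mulKf ?pnatr_eq0.
Qed.

Let star o x := forced t o k true true x.

(** If seat [b] owns [k], the two weights are twice the counts for the two values of coin [k].
    Reassigning [k] to [b] is free, as [forced] overrides the owner of [k]. *)
Lemma hel_forced_influence o (b : bool) :
  \sum_x hel (forced t o k false false x) (forced t o k (~~ b) b x) <=
  2 * influence R (leaf t (force k b o)) k.
Proof.
rewrite /influence mulr_sumr; apply: ler_sum => x _.
have := forced_count (force k b o) false x; rewrite !andbF => e0.
have := forced_count (force k b o) true x; rewrite !andbT ffunE eqxx.
have -> : (b == false) = ~~ b by case: (b).
have -> : (b == true) = b by case: (b).
rewrite -(forced_set_own t o k b) -[X in hel _ X](forced_set_own t o k b) e0 => ->.
rewrite hel_scale // ler_wpM2l // helC.
by apply: le_trans (hel_le_triangular _ _) _; rewrite ?count_at_ge0.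
Qed.

(** By cut and paste, neither-versus-both is as far apart as first-only-versus-second-only, and
    these two are compared through neither. *)
Lemma hel_star o : \sum_x hel (leaf_count t o x) (star o x) <=
  8 * (influence R (leaf t (force k false o)) k + influence R (leaf t (force k true o)) k).
Proof.
have d1 := hel_forced_influence o false; have d2 := hel_forced_influence o true.
move: d1 d2; rewrite /=.
set d1 := \sum_x _; set d2 := \sum_x _ => H1 H2.
pose X := \sum_x hel (forced t o k false false x) (star o x).
have d10 : 0 <= d1 by apply: sumr_ge0 => *; exact: hel_ge0.
have d20 : 0 <= d2 by apply: sumr_ge0 => *; exact: hel_ge0.
have hX : X <= 2 * d1 + 2 * d2.
  rewrite /X (@hel_cut_paste _ _ _ (forced t o k true false) (forced t o k false true)
    _ (2 ^+ #|{: K}|)); try by [move=> *; exact: forced_ge0|exact: forced_total|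
     move=> *; exact: cut_paste].
  rewrite /d1 /d2 !mulr_sumr -big_split /=; apply: ler_sum => x _.
  by rewrite [X in 2 * X + _]helC [X in _ + 2 * X]helC; exact: hel_triangle.
pose b := o k; pose db := \sum_x hel (forced t o k false false x) (forced t o k (~~ b) b x).
have hdb : db <= d1 + d2.
  rewrite /db /d1 /d2; case: (b) => /=; rewrite ?lerDl ?lerDr //.
have hb : \sum_x hel (forced t o k (~~ b) b x) (star o x) <= 2 * db + 2 * X.
  rewrite /db /X !mulr_sumr -big_split /=; apply: ler_sum => x _.
  by rewrite [X in _ <= 2 * X + _]helC [X in _ + 2 * X]helC; exact: hel_triangle.
(* Convexity applied to [leaf_countE]. The right side is [3/2 * X + db], at most [4 * (d1 + d2)];
   each of [d1], [d2] is at most twice an influence. *)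
have : \sum_x hel (leaf_count t o x) (star o x) <= 2^-1 * X + 2^-1 * (2 * db + 2 * X).
  apply: (@le_trans _ _ (2^-1 * X + 2^-1 *
       \sum_x hel (forced t o k (~~ b) b x) (star o x))); last first.
    by rewrite lerD2l ler_wpM2l // invr_ge0.
  rewrite /X !mulr_sumr -big_split /=; apply: ler_sum => x _.
  rewrite leaf_countE.
  have -> : star o x = 2^-1 * star o x + 2^-1 * star o x by field.
  apply: le_trans (helD _ _ _ _) _; rewrite ?mulr_ge0 ?forced_ge0 ?invr_ge0 //.
  have -> : 2^-1 * star o x + 2^-1 * star o x = star o x by field.
  by rewrite !hel_scale ?invr_ge0.
lra.
Qed.

End OneCoordinate.

Lemma sum_own k (F : B -> R) :
  \sum_o (F (force k false o) + F (force k true o)) = 2 * \sum_o F o.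
Proof.
pose fl (o : B) := force k (~~ o k) o.
have flK : involutive fl.
  move=> o; apply/ffunP => k'; rewrite !ffunE eqxx; case: eqVneq => // ->.
  by rewrite negbK.
rewrite mulr_natl mulr2n [X in _ = _ + X](reindex_inj (inv_inj flK)) -big_split /=.
apply: eq_bigr => o _.
have keep : force k (o k) o = o.
  by apply/ffunP => k'; rewrite ffunE; case: eqVneq => // ->.
have -> : F o = F (force k (o k) o) by rewrite keep.
by rewrite /fl; case: (o k); rewrite //= addrC.
Qed.

Definition upd (i : I) (e : 'I_m) t : T := [ffun j => if j == i then e else t j].

Lemma updE i e t : upd i e t i = e.
Proof. by rewrite ffunE eqxx. Qed.

Lemma upd_id i e t : t i = e -> upd i e t = t.
Proof. by move=> <-; apply/ffunP => j; rewrite ffunE; case: eqVneq => // ->. Qed.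

Lemma upd_upd i e e' t : upd i e (upd i e' t) = upd i e t.
Proof. by apply/ffunP => j; rewrite !ffunE; case: eqVneq. Qed.

(** On both sides [e] and [e'] are common in slot [i], whatever their owners and coins, and nothing
    else differs. *)
Lemma forced_upd t o i e e' x : t i = e ->
  forced t o (i, e') true true x = forced (upd i e' t) o (i, e) true true x.
Proof.
move=> te; apply: eq_bigl => c; congr (Pi _ _ == x); apply/ffunP => -[j u];
  rewrite !ffunE /= !xpair_eqE; case: (eqVneq j i) => [->|_] //=; rewrite te;
  by case: (u == e); case: (u == e').
Qed.

Definition hel_update i (e e' : 'I_m) : R :=
  \sum_(t : T | t i == e) \sum_(o : B) \sum_x hel (leaf_count t o x) (leaf_count (upd i e' t) o x).

Definition hel_to_star i (e e' : 'I_m) : R :=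
  \sum_(t : T | t i == e) \sum_(o : B) \sum_x hel (leaf_count t o x) (forced t o (i, e') true true x).

(* [t i = e] and [t i = e'] are compared through the input where both [e] and [e'] are common. *)
Lemma hel_update_le i e e' :
  hel_update i e e' <= 2 * hel_to_star i e e' + 2 * hel_to_star i e' e.
Proof.
have -> : hel_to_star i e' e = \sum_(t : T | t i == e) \sum_o \sum_x
    hel (leaf_count (upd i e' t) o x) (forced t o (i, e') true true x).
  rewrite /hel_to_star (reindex_onto (upd i e') (upd i e)) /=; last first.
    by move=> t /eqP te; rewrite upd_upd upd_id.
  apply: eq_big => t.
    rewrite updE eqxx upd_upd /=; apply/eqP/eqP => [<-|/upd_id //].
    exact: updE.
  rewrite updE eqxx upd_upd /= => /eqP tt; apply: eq_bigr => o _; apply: eq_bigr => x _.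
  by rewrite -forced_upd // -tt updE.
rewrite /hel_update /hel_to_star !mulr_sumr -big_split /=; apply: ler_sum => t _.
rewrite !mulr_sumr -big_split /=; apply: ler_sum => o _.
rewrite !mulr_sumr -big_split /=; apply: ler_sum => x _.
exact: hel_triangle.
Qed.

(** [hel_star] applies because [e' != e = t i]. Summing over owners doubles its constant by
    [sum_own], and summing over [e] restores the sum over all [t]. *)
Lemma sum_hel_to_star i :
  \sum_e \sum_(e' | e' != e) hel_to_star i e e' <=
  16 * \sum_(t : T) \sum_(o : B) \sum_e influence R (leaf t o) (i, e).
Proof.
pose J t o e := influence R (leaf t o) (i, e).
have J0 t o e : 0 <= J t o e by exact: influence_ge0.
apply: (@le_trans _ _ (\sum_e \sum_e' \sum_(t : T | t i == e)
    \sum_o 8 * (J t (force (i, e') false o) e' + J t (force (i, e') true o) e'))).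
  apply: ler_sum => e _; rewrite [leRHS](bigID (fun e' => e' != e)) /=.
  apply: ler_wpDr.
    apply: sumr_ge0 => e' _; apply: sumr_ge0 => t _; apply: sumr_ge0 => o _.
    by rewrite mulr_ge0 ?addr_ge0.
  apply: ler_sum => e' ne; apply: ler_sum => t /eqP te; apply: ler_sum => o _.
  by apply: hel_star; rewrite /= te.
under eq_bigr do under eq_bigr do under eq_bigr do rewrite -mulr_sumr (sum_own _ (fun o => J _ o _)).
rewrite exchange_big /=.
under eq_bigr => e' _.
  rewrite -(@partition_big R 0 +%R T (index_enum _) _ predT (fun t : T => t i) predT
    (fun t => 8 * (2 * \sum_o J t o e')) (fun _ _ => erefl)).
  over.
rewrite exchange_big mulr_sumr /=; apply: ler_sum => t _.
rewrite [X in _ <= _ * X]exchange_big mulr_sumr /=; apply: ler_sum => e _.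
by rewrite mulrA -natrM.
Qed.

Let W := (T * B * B)%type.

(** Data processing passes to the finer [G'], which reveals the transcript, the owners and [t]
    outside slot [i]. Its posteriors are proportional to leaf counts. *)
Lemma sum_hel_post_le (F : eqType) (G : W -> F) i e e' :
  (forall w w' : W, leaf w.1.1 w.1.2 w.2 = leaf w'.1.1 w'.1.2 w'.2 ->
     (forall j, j != i -> w.1.1 j = w'.1.1 j) -> G w = G w') ->
  \sum_w hel (post R G (fun w => w.1.1 i) e w) (post R G (fun w => w.1.1 i) e' w) <=
  hel_update i e e'.
Proof.
move=> refine.
pose G' (w : W) := (leaf w.1.1 w.1.2 w.2, upd i e w.1.1, w.1.2).
apply: le_trans (@sum_hel_coarsen _ _ _ _ _ G' _ _ _ _ _) _.
  move=> w w' [e1 e2 _]; apply: refine => // j ji.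
  by have := congr1 (fun t : T => t j) e2; rewrite !ffunE (negbTE ji).
have numer (w : W) e0 : \sum_(w' | G' w' == G' w) (w'.1.1 i == e0)%:R =
    leaf_count (upd i e0 w.1.1) w.1.2 (leaf w.1.1 w.1.2 w.2).
  case: w => [[t o] c] /=; rewrite big_mkcond /=.
  rewrite -(pair_bigA _ (fun (p : T * B) c' => if G' (p, c') == G' (t, o, c)
     then (p.1 i == e0)%:R else 0)) /=.
  rewrite (bigD1 (upd i e0 t, o)) //= [X in _ + X]big1 ?addr0.
    rewrite /leaf_count [RHS]big_mkcond /=; apply: eq_bigr => c' _.
    by rewrite updE eqxx /G' /= upd_upd !xpair_eqE !eqxx !andbT.
  move=> [t' o'] /= ne; apply: big1 => c' _; rewrite /G' /=.
  case: eqP => // -[_ e2 e3]; case: eqP => // te; move: ne; rewrite e3.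
  suff -> : upd i e0 t = t' by rewrite eqxx.
  apply/ffunP => j; rewrite ffunE; case: eqVneq => [->//|ji].
  by have := congr1 (fun t : T => t j) e2; rewrite !ffunE (negbTE ji).
(* Values of [G'] have [e] in slot [i]; elsewhere [H] is 0, as [sum_fibres] demands for values not
   attained. *)
pose H (g : E * T * B) := if g.1.2 i == e then
  hel (leaf_count g.1.2 g.2 g.1.1) (leaf_count (upd i e' g.1.2) g.2 g.1.1) else 0.
rewrite (eq_bigr (fun w => H (G' w) / fibsize R G' w)); last first.
  move=> w _; rewrite /post /cavg !numer mulrC [X in hel _ X]mulrC hel_scale; last first.
    by rewrite invr_ge0 ltW ?fibsize_gt0.
  by rewrite mulrC /H /G' /= updE eqxx upd_upd.
rewrite sum_fibres; last first.
  move=> [[x t] o] none; rewrite /H /=; case: eqP => // te.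
  have z e0 : leaf_count (upd i e0 t) o x = 0.
    apply: big_pred0 => c; apply/negbTE/eqP => lc.
    by have := none (upd i e0 t, o, c); rewrite /G' /= upd_upd (upd_id te) lc eqxx.
  by have := z e; rewrite (upd_id te) => ->; rewrite z hel00.
rewrite -(pair_bigA _ (fun p o => H (p, o))) /= -(pair_bigA _ (fun x t => \sum_o H (x, t, o))) /=.
rewrite exchange_big /hel_update /= [leRHS]big_mkcond /=; apply: ler_sum => t _.
rewrite exchange_big /= /H /=; case: (t i == e) => //.
by rewrite big1 // => o _; rewrite big1.
Qed.

(** For fixed [t] and [o], one level-one inequality covers the coins of all slots together, so the
    number of slots does not enter. The constant is 4 (symmetrised [hel_update_le]) times 16 times
    8. *)
Lemma sum_hel_post_total n (P : pred I) (F : eqType) (G : I -> W -> F) :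
  (forall t o, #|[set leaf t o c | c in predT]| <= 2 ^ n)%N ->
  (forall i (w w' : W), P i -> leaf w.1.1 w.1.2 w.2 = leaf w'.1.1 w'.1.2 w'.2 ->
     (forall j, j != i -> w.1.1 j = w'.1.1 j) -> G i w = G i w') ->
  \sum_(i | P i) \sum_e \sum_e' \sum_w
    hel (post R (G i) (fun w => w.1.1 i) e w) (post R (G i) (fun w => w.1.1 i) e' w) <=
  512 * n%:R * #|{: W}|%:R.
Proof.
move=> few refine.
apply: (@le_trans _ _ (\sum_(i | P i) 64 * \sum_(t : T) \sum_(o : B) \sum_e influence R (leaf t o) (i, e))).
  apply: ler_sum => i Pi0.
  apply: (@le_trans _ _ (\sum_e \sum_(e' | e' != e)
    (2 * hel_to_star i e e' + 2 * hel_to_star i e' e))).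
    apply: ler_sum => e _; rewrite (bigD1 e) //= [X in X + _]big1 ?add0r; last first.
      by move=> w _; rewrite helxx.
    apply: ler_sum => e' _; apply: le_trans (hel_update_le _ _ _).
    by apply: sum_hel_post_le => w w'; exact: refine.
  have -> : \sum_e \sum_(e' | e' != e) (2 * hel_to_star i e e' + 2 * hel_to_star i e' e) =
      4 * \sum_e \sum_(e' | e' != e) hel_to_star i e e'.
    under eq_bigr do rewrite big_split /= -!mulr_sumr.
    rewrite big_split /= -!mulr_sumr.
    have -> : \sum_e \sum_(e' | e' != e) hel_to_star i e' e =
        \sum_e \sum_(e' | e' != e) hel_to_star i e e'.
      rewrite (exchange_big_dep predT) //=; apply: eq_bigr => e _.
      by apply: eq_bigl => e'; rewrite eq_sym.
    by ring.
  by have := sum_hel_to_star i; lra.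
apply: (@le_trans _ _ (\sum_i 64 * \sum_(t : T) \sum_(o : B) \sum_e influence R (leaf t o) (i, e))).
  rewrite [leRHS](bigID P) /= lerDl sumr_ge0 // => i _; rewrite mulr_ge0 // sumr_ge0 // => t _.
  rewrite sumr_ge0 // => o _; rewrite sumr_ge0 // => e _; exact: influence_ge0.
rewrite -mulr_sumr exchange_big /=.
apply: (@le_trans _ _ (64 * \sum_(t : T) \sum_(o : B) (8 * n%:R * 2 ^+ #|{: K}|))).
  rewrite ler_wpM2l //; apply: ler_sum => t _; rewrite exchange_big /=; apply: ler_sum => o _.
  rewrite pair_bigA /=.
  apply: le_trans (@sum_influence_le R _ _ (leaf t o) n (few t o)).
  by apply: ler_sum => -[].
have -> : #|{: W}| = (#|{: T}| * #|{: B}| * 2 ^ #|{: K}|)%N.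
  by rewrite -[in (2 ^ _)%N]card_bool -card_ffun -!card_prod.
rewrite !sumr_const -!mulrnA -[X in 64 * X]mulr_natr !natrM natrX.
rewrite (_ : 64 * _ = 512 * n%:R * (#|{: T}|%:R * #|{: B}|%:R * 2 ^+ #|{: K}|)) //.
by ring.
Qed.

End Core.

(** * Executions of protocols: rectangle property and encoding of histories *)

Definition is_CD (t : team) : bool := if t is CD then true else false.
Definition team_of (b : bool) : team := if b then CD else AB.

Lemma is_CDK : cancel is_CD team_of. Proof. by case. Qed.

HB.instance Definition _ := Equality.copy team (can_type is_CDK).

Lemma prefix_of_cat (A : eqType) (u u' v v' : seq A) :
  u ++ v = u' ++ v' -> (size u <= size u')%N -> prefix u u'.
Proof.
by move=> e le; rewrite prefixE -(takel_cat v' le) -e take_size_cat.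
Qed.

Section Protocols.

(** The rectangle property of a two-party tree: each node queries one seat, on which [x] and [x']
    answer alike. *)
Lemma play_mix (I : Type) (c : round I) (x x' y : seat -> I) :
  play c x = play c x' -> (forall s, y s = x s \/ y s = x' s) ->
  play c y = play c x.
Proof.
move=> + hy; elim: c => [s f next IH|s f] /=.
  move=> e.
  have fs : f (x s) = f (x' s).
    by move: e; case: (play (next (f (x s))) x) => ? ?; case: (play (next (f (x' s))) x') => ? ? [].
  have -> : f (y s) = f (x s) by case: (hy s) => ->.
  rewrite (IH (f (x s))) // {2}fs.
  move: e; rewrite -fs; case: (play _ x) => ? ?; case: (play _ x') => ? ?.
  by case=> -> ->.
by move=> [e]; case: (hy s) => ->; rewrite ?e.
Qed.

(** The conversations of one tree are prefix-free, since equal bits lead to the same node. *)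
Lemma play_prefix (I : Type) (c : round I) (x x' : seat -> I) a a' :
  (play c x).1 ++ a = (play c x').1 ++ a' -> (play c x).1 = (play c x').1.
Proof.
elim: c => [s f next IH|s f] //=.
have := IH (f (x s)).
case e1 : (play (next (f (x s))) x) => [u w]; case e2 : (play (next (f (x' s))) x') => [u' w'] /=.
move=> H [fs e]; rewrite -fs in e2 *; congr cons.
by move: H; rewrite e2; exact.
Qed.

Variables (m r : nat) (s : strategy m r).

Definition run_upto (x : instance m r) k : history := iter k (run_round s x) [::].

Lemma size_run_upto x k : size (run_upto x k) = k.
Proof.
elim: k => //= k IH; rewrite /run_round -/(run_upto x k).
by case: (play _ _) => ? ?; rewrite size_rcons IH.
Qed.

Definition speaker k : team := if odd k then other (opening s) else opening s.

Lemma run_uptoS x k : run_upto x k.+1 =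
  let p := play (plan s (speaker k) (view (speaker k) (run_upto x k))) (held x (speaker k)) in
  rcons (run_upto x k) (speaker k, p.1, p.2).
Proof.
rewrite /run_upto iterS -/(run_upto x k) /run_round size_run_upto -/(speaker k).
by case: (play _ _).
Qed.

Lemma run_upto_mix (x x' y : instance m r) k :
  (forall t s', held y t s' = held x t s' \/ held y t s' = held x' t s') ->
  run_upto x k = run_upto x' k -> run_upto y k = run_upto x k.
Proof.
move=> hy; elim: k => // k IH; rewrite !run_uptoS /= => /rcons_inj [e].
rewrite IH // -e.
set c := plan _ _ _ => e1 e2.
rewrite (@play_mix _ c (held x (speaker k)) (held x' (speaker k))) //.
by move: e1 e2; case: (play c _) => ? ?; case: (play c _) => ? ? /= -> ->.
Qed.

Lemma run_cat x k : (k <= r)%N -> exists l, run s x = run_upto x k ++ l.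
Proof.
move=> kr; have -> : run s x = iter (r - k) (run_round s x) (run_upto x k).
  by rewrite /run_upto -iterD subnK.
elim: (r - k)%N => [|j [l IH]]; first by exists [::]; rewrite cats0.
rewrite iterS IH /run_round; case: (play _ _) => u w.
by eexists; rewrite rcons_cat; reflexivity.
Qed.

Lemma take_run x k : (k <= r)%N -> take k (run s x) = run_upto x k.
Proof.
by move=> /(run_cat x)[l ->]; rewrite take_size_cat // size_run_upto.
Qed.

Definition encode (h : history) : bits := flatten [seq e.1.2 ++ e.2 | e <- h].

Lemma size_encode x : size (encode (run s x)) = cost s x.
Proof.
rewrite /encode /cost size_flatten /shape -map_comp sumnE big_map.
by apply: eq_bigr => e _ /=; rewrite size_cat.
Qed.

(** Decoding goes round by round. The conversation is cut off by [play_prefix]; of the two messages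
    one is then a prefix of the other, so self-delimitation makes them equal. *)
Lemma encode_inj (x x' : instance m r) : self_delimiting s -> promise x -> promise x' ->
  encode (run s x) = encode (run s x') -> run s x = run s x'.
Proof.
move=> sd px px' enc.
suff H k : (k <= r)%N -> run_upto x k = run_upto x' k by exact: H.
elim: k => // k IH kr; have e := IH (ltnW kr).
have [l el] := run_cat x kr; have [l' el'] := run_cat x' kr.
have := sd x x' k px px'; move: enc.
rewrite el el' !run_uptoS -e /=.
set c := plan _ _ _; set p := play c (held x _); set p' := play c (held x' _).
rewrite /messages /encode !map_cat !map_rcons !flatten_cat !flatten_rcons -!catA => /eqP.
rewrite eqseq_cat // eqxx /= => /eqP enc.
have e1 : p.1 = p'.1 by exact: play_prefix enc.
move: enc; rewrite e1 => /eqP; rewrite eqseq_cat // eqxx /= => /eqP enc.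
have sz : size [seq e.2 | e <- run_upto x k] = k by rewrite size_map size_run_upto.
rewrite !cat_rcons !take_size_cat // !nth_cat sz ltnn subnn /= => /(_ erefl) D.
congr (rcons _ (_, _, _)).
have [le|/ltnW le] := leqP (size p.2) (size p'.2).
  exact/D/(prefix_of_cat enc).
have := sd x' x k px' px.
rewrite el el' !run_uptoS -e /= /messages !map_cat !map_rcons -/c -/p -/p'.
rewrite !cat_rcons !take_size_cat // !nth_cat sz ltnn subnn /= => /(_ erefl) D'.
exact/esym/D'/(prefix_of_cat (esym enc)).
Qed.

End Protocols.

(** The final [true] marks the end of the string against the default [false]. *)
Lemma nth_rcons_inj (s s' : bits) :
  (forall i, nth false (rcons s true) i = nth false (rcons s' true) i) -> s = s'.
Proof.
wlog le : s s' / (size s <= size s')%N => [H e|e].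
  by have [le|/ltnW le] := leqP (size s) (size s'); [|apply/esym]; apply: H.
have sz : size s = size s'.
  apply/eqP; rewrite eqn_leq le /= leqNgt; apply/negP => lt.
  by have := e (size s'); rewrite !nth_rcons ltnn eqxx ltnNge le /= gtn_eqF.
apply: (@eq_from_nth _ false) => // i ilt.
by have := e i; rewrite !nth_rcons -sz ilt.
Qed.

Lemma card_image_code (T E C : finType) (f : T -> E) (code : T -> C) :
  (forall x y, code x = code y -> f x = f y) ->
  (#|[set f x | x in predT]| <= #|C|)%N.
Proof.
move=> H; apply: (@leq_trans #|[set code x | x in predT]|); last exact: max_card.
pose g (e : E) : option C := omap code [pick x | f x == e].
rewrite -(card_in_imset (f := g) (D := [set f x | x in predT])).
  have sI : injective (@Some C) by move=> ? ? [].
  rewrite -(card_imset (mem [set code x | x in predT]) sI).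
  apply/subset_leq_card/fintype.subsetP => _ /imsetP[_ /imsetP[x _ ->] ->].
  rewrite /g; case: pickP => [y _|/(_ x)]; last by rewrite eqxx.
  by apply/imset_f/imset_f.
move=> _ _ /imsetP[x _ ->] /imsetP[y _ ->]; rewrite /g.
case: pickP => [x' /eqP <-|/(_ x)]; last by rewrite eqxx.
case: pickP => [y' /eqP <-|/(_ y)]; last by rewrite eqxx.
by move=> [/H].
Qed.

(** * Conditional independence from an exchange of inputs *)

Section Independence.
Variables (R : rcfType) (W : finType) (m : nat) (E E' : eqType).
Variables (G : W -> E) (G' : W -> E') (U : W -> 'I_m) (F : 'I_m -> W -> 'I_m).
Variable mix : W -> W -> W.
Hypothesis mixK : forall a b, mix (mix a b) (mix b a) = a.
Hypothesis mixG' : forall a b, G a = G b -> G' (mix a b) = G' a.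
Hypothesis mixF : forall u a b, F u (mix a b) = F u b.
Hypothesis G'G : forall a b, G' a = G' b -> G a = G b.
Hypothesis G'U : forall a b, G' a = G' b -> U a = U b.

(** After clearing denominators both sides count pairs of a point in the fibre of [G'] and one in
    the fibre of [G]. The exchange by [mix] moves the condition on [F] from one point to the
    other. *)
Lemma post_indep w z :
  post R G' (fun w' => F (U w') w') z w = post R G (F (U w)) z w.
Proof.
have mixG a b : G a = G b -> G (mix a b) = G a by move=> /mixG'/G'G.
have indic (H : eqType) (K : W -> H) (X : W -> 'I_m) :
    \sum_(w' | K w' == K w) (X w' == z)%:R = \sum_(w' | (K w' == K w) && (X w' == z)) 1 :> R.
  by rewrite big_mkcondr; apply: eq_bigr => w' _; case: (X w' == z).
have N0 := fibsize_neq0 R G w; have N0' := fibsize_neq0 R G' w.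
rewrite /post /cavg !indic.
apply: (mulIf N0); rewrite mulrAC [RHS]mulfVK //; apply: (mulIf N0'); rewrite mulfVK //.
rewrite [RHS]mulrC /fibsize.
rewrite (eq_bigl (fun w' => (G' w' == G' w) && (F (U w) w' == z))); last first.
  by move=> w'; case: eqP => //= /G'U ->.
apply: (@count_swap _ _ (fun p => (mix p.1 p.2, mix p.2 p.1))).
  by move=> [a b]; rewrite /= !mixK.
move=> [a b] /=; rewrite mixF; apply/idP/idP.
  move=> /andP[/eqP e1 /andP[/eqP e2 /eqP ->]].
  have e : G (mix a b) = G (mix b a) by rewrite e2 (G'G e1).
  have := mixG' e; have := mixG _ _ (esym e); rewrite !mixK => -> ->.
  by rewrite e1 e2 !eqxx.
move=> /andP[/andP[/eqP e1 /eqP ->] /eqP e2].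
have e : G a = G b by rewrite e2 (G'G e1).
by rewrite mixG' // mixG // e1 e2 !eqxx.
Qed.

End Independence.

(** * The hard distribution and the recursion along the pointer path *)

Section HardDistribution.
Variables (R : realType) (m' r' : nat).
Let m := m'.+1.
Let r := r'.+1.
Let I := (bool * ('I_r * 'I_m))%type.
Let K := (I * 'I_m)%type.
Let B := {ffun K -> bool}.
Let T := {ffun I -> 'I_m}.
Let W := (T * B * B)%type.

(** [f] gathers the sets of the first seats of both teams and [g] those of the second seats: the
    four players become the two sides of a rectangle. *)
Definition inst (f g : B) : instance m r :=
  let inp b (h : B) : input m r := [ffun ju => [set e | h ((b, ju), e)]] in
  Instance (inp false f) (inp false g) (inp true f) (inp true g).

Lemma heldE f g t s : held (inst f g) t s =
  [ffun ju => [set e | (if s is First then f else g) ((is_CD t, ju), e)]].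
Proof. by case: t; case: s. Qed.

Definition hard (w : W) : instance m r :=
  inst (seatset w.1.1 w.1.2 w.2 false) (seatset w.1.1 w.1.2 w.2 true).

Lemma common_hard (w : W) t j u : common (hard w) t j u = [set w.1.1 (is_CD t, (j, u))].
Proof.
apply/setP => e; rewrite /common !heldE !ffunE !inE !ffunE /=.
by case: (e == _) => //=; case: (w.1.2 _); rewrite /= ?andbF.
Qed.

Lemma hard_promise w : promise (hard w).
Proof. by move=> t j u; rewrite common_hard cards1. Qed.

(* The function applied to [z_k]; layer [k.+1] of the problem is the ordinal [k]. *)
Definition next (k : nat) (u : 'I_m) (w : W) : 'I_m := w.1.1 (odd k, (inord k : 'I_r, u)).

Fixpoint path (w : W) (k : nat) : 'I_m :=
  if k is k'.+1 then next k' (path w k') w else ord0.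

Lemma pointer_hard w k : (k <= r)%N -> pointer (hard w) k = Some (path w k).
Proof.
elim: k => [|k IH] kr /=; first by rewrite insubT; congr Some; exact: val_inj.
rewrite IH ?(ltnW kr) // insubT /= common_hard set1K /next.
congr (Some (w.1.1 (_, (_, _)))); first by case: (odd k).
by apply: val_inj; rewrite /= inordK.
Qed.

Variable s : strategy m r.

(** Contains the private conversations of both teams and the pointers strictly before z_k. With
    these fixed, one team's inputs can be exchanged without disturbing the other's. *)
Definition state (k : nat) (w : W) : history * seq 'I_m :=
  (run_upto s (hard w) k, [seq path w j | j <- iota 0 k]).

Lemma state_path k w w' j : state k w = state k w' -> (j < k)%N -> path w j = path w' j.
Proof.
move=> [_ e] jk; have := congr1 (fun l => nth ord0 l j) e.
by rewrite !(nth_map 0%N) ?size_iota // nth_iota.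
Qed.

Lemma state_pred k w w' : state k.+1 w = state k.+1 w' -> state k w = state k w'.
Proof.
move=> e; have e1 : run_upto s (hard w) k.+1 = run_upto s (hard w') k.+1.
  exact: (congr1 (fun p : history * seq _ => p.1) e).
congr pair; first by move: e1; rewrite !run_uptoS => /rcons_inj[].
by apply/eq_in_map => j; rewrite mem_iota add0n => /ltnW; exact: state_path e.
Qed.

Definition mix_team (b : bool) (w w' : W) : W :=
  ([ffun i => (if i.1 == b then w' else w).1.1 i],
   [ffun k => (if k.1.1 == b then w' else w).1.2 k],
   [ffun k => (if k.1.1 == b then w' else w).2 k]).

Lemma mix_teamK b w w' : mix_team b (mix_team b w w') (mix_team b w' w) = w.
Proof.
case: w w' => [[t o] c] [[t' o'] c']; rewrite /mix_team /=.
by congr (_, _, _); apply/ffunP => k; rewrite !ffunE; case: ifP => e; rewrite ffunE /= e.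
Qed.

Lemma held_mix b w w' t s' : held (hard (mix_team b w w')) t s' =
  held (hard (if is_CD t == b then w' else w)) t s'.
Proof.
rewrite !heldE; apply/ffunP => ju; rewrite !ffunE; apply/setP => e; rewrite !inE.
by case: s'; rewrite !ffunE /=; case: ifP.
Qed.

Lemma next_mix k u w w' : next k u (mix_team (odd k) w w') = next k u w'.
Proof. by rewrite /next ffunE eqxx. Qed.

Hypothesis s_misaligned : opening s = CD.

Lemma is_CD_speaker k : is_CD (speaker s k) = ~~ odd k.
Proof. by rewrite /speaker s_misaligned; case: (odd k). Qed.

(* In round [k.+1] the team owning layer [k.+1] is silent, so its inputs
   can be exchanged between two executions in the same state. *)
Lemma state_mix k w w' : state k w = state k w' ->
  state k.+1 (mix_team (odd k) w w') = state k.+1 w.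
Proof.
move=> e; have [eh _] := e.
have run_mix : run_upto s (hard (mix_team (odd k) w w')) k = run_upto s (hard w) k.
  apply: run_upto_mix eh => t s'; rewrite held_mix; case: ifP; by [right|left].
congr pair.
  rewrite !run_uptoS run_mix /=; congr (rcons _ (_, _, _));
  congr (_ (play _ _)); apply/funext => s'; rewrite held_mix is_CD_speaker;
  by case: (odd k).
apply/eq_in_map => j; rewrite mem_iota add0n ltnS /=; elim: j => // j IH jk /=.
rewrite IH ?(ltnW jk) // {1}/next ffunE /=; case: eqP => // odd_eq.
(* Equal parity excludes [j.+1 = k], so z_(j+1) is already recorded in the state and agrees in [w]
   and [w']. *)
have jk1 : (j.+1 < k)%N.
  by rewrite ltn_neqAle jk andbT; apply/eqP => jk'; move: odd_eq; rewrite -jk' /=; case: (odd j).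
have := state_path e jk1; rewrite /= (state_path e jk) => ->.
by rewrite /next.
Qed.

Lemma dev_state_step k :
  dev R (state k.+1) (fun w => path w k.+1) <=
  dev R (state k) (fun w => path w k) + 2 / m%:R * \sum_u dev R (state k) (next k u).
Proof.
apply: dev_step => // w z.
apply: (@post_indep _ _ _ _ _ _ _ (fun w => path w k) (next k) (mix_team (odd k))).
- exact: mix_teamK.
- exact: state_mix.
- exact: next_mix.
- exact: state_pred.
- by move=> a b /state_path; apply.
Qed.

(** Before any communication the state is constant, and transposing [e] and [e'] in the slot
    preserves the uniform law. *)
Lemma dev_state0 u : dev R (state 0) (next 0 u) = 0.
Proof.
apply/le_anti/andP; split; last by apply: sumr_ge0 => w _; exact: lawdev_ge0.
apply: le_trans (dev_le_hel _ _ _ _) _ => //.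
rewrite big1 ?mulr0 // => e _; rewrite big1 // => e' _; rewrite big1 // => w _.
suff -> : post R (state 0) (next 0 u) e w = post R (state 0) (next 0 u) e' w by rewrite helxx.
congr (_ / _).
pose i : I := (odd 0, (inord 0, u)).
pose sw (w : W) : W := ([ffun j => if j == i then tperm e e' (w.1.1 j) else w.1.1 j], w.1.2, w.2).
have swK : involutive sw.
  move=> [[t o] c]; rewrite /sw /=; congr (_, _, _); apply/ffunP => j; rewrite !ffunE.
  by case: (j == i); rewrite ?tpermK.
rewrite (reindex_inj (inv_inj swK)) /=; apply: eq_bigr => w' _.
rewrite /next /sw /= ffunE eqxx; congr (nat_of_bool _)%:R.
by rewrite (inv_eq (@tpermK _ e e')) tpermL.
Qed.

Lemma dev_state_sum k : dev R (state k.+1) (fun w => path w k.+1) <=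
  2 / m%:R * \sum_(0 <= j < k.+1) \sum_u dev R (state j) (next j u).
Proof.
elim: k => [|k IH].
  have : dev R (state 1) (fun w => path w 1) <= \sum_u dev R (state 0) (next 0 u).
    apply: (@dev_step_init _ _ _ _ _ _ _ (fun w => path w 0) (next 0)) => // w z.
    apply: (@post_indep _ _ _ _ _ _ _ (fun w => path w 0) (next 0) (mix_team (odd 0))) => //.
    - exact: mix_teamK.
    - exact: state_mix.
    - exact: next_mix.
  rewrite big1 => [H|u _]; last exact: dev_state0.
  rewrite big_nat1 (eq_bigr (fun=> 0)) => [|u _]; last exact: dev_state0.
  by rewrite big1 ?mulr0.
apply: le_trans (dev_state_step _) _.
by rewrite [X in _ <= _ * X]big_nat_recr //= mulrDr lerD2r.
Qed.

Let E := {set B * B}.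

(* A transcript is replaced by the set of inputs producing it, to get a [finType]. *)
Definition transcript (f g : B) : E := [set p | `[< run s (inst p.1 p.2) = run s (inst f g) >]].

Lemma transcriptP f g f' g' :
  transcript f g = transcript f' g' <-> run s (inst f g) = run s (inst f' g').
Proof.
split=> [/setP/(_ (f, g))|e]; last by apply/setP => p; rewrite !inE e.
by rewrite !inE /= => h; apply/asboolP; rewrite -h; apply/asboolP.
Qed.

Lemma transcript_rect f g f' g' :
  transcript f g = transcript f' g' -> transcript f g' = transcript f g.
Proof.
move=> /transcriptP e; apply/transcriptP; apply: run_upto_mix e => t s'.
by rewrite !heldE; case: s'; [left|right].
Qed.

Variable n : nat.
Hypothesis s_delim : self_delimiting s.
Hypothesis s_cost : forall x, promise x -> (cost s x <= n)%N.

Lemma few_transcripts t o :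
  (#|[set leaf transcript t o c | c in predT]| <= 2 ^ n.+1)%N.
Proof.
pose code (c : B) : {ffun 'I_n.+1 -> bool} :=
  (* At most [n] bits of encoding, and one more for the end marker. *)
  [ffun i : 'I_n.+1 => nth false (rcons (encode (run s (hard (t, o, c)))) true) i].
apply: leq_trans (@card_image_code _ _ _ _ code _) _; last first.
  by rewrite card_ffun card_bool card_ord.
move=> c c' e; apply/transcriptP.
apply: (@encode_inj _ _ s (hard (t, o, c)) (hard (t, o, c'))) => //; try exact: hard_promise.
have le (d : B) : (size (encode (run s (hard (t, o, d)))) <= n)%N.
  by rewrite size_encode s_cost //; exact: hard_promise.
apply: nth_rcons_inj => i; have [i_lt|i_ge] := ltnP i n.+1.
  by have := congr1 (fun f : {ffun 'I_n.+1 -> bool} => f (Ordinal i_lt)) e; rewrite !ffunE.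
by rewrite !nth_default // size_rcons (leq_trans _ i_ge) // ltnS.
Qed.

Lemma dev_final : dev R (state r) (fun w => path w r) <=
  4096 * n.+1%:R * #|{: W}|%:R / m%:R ^+ 2.
Proof.
have m0 : 0 < m%:R :> R by rewrite ltr0n.
apply: le_trans (dev_state_sum _) _.
pose G (i : I) := state i.2.1.
(* The slots whose team owns their layer, the only ones that [next] reads. *)
pose P (i : I) := i.1 == odd i.2.1.
pose H (i : I) := \sum_e \sum_e' \sum_w
  hel (post R (G i) (fun w : W => w.1.1 i) e w) (post R (G i) (fun w => w.1.1 i) e' w).
have tot : \sum_(i | P i) H i <= 512 * n.+1%:R * #|{: W}|%:R.
  apply: (@sum_hel_post_total R I m E transcript transcript_rect n.+1 P _ G).
    exact: few_transcripts.
  move=> [b [k u]] w w' /eqP /= bk /transcriptP e off; rewrite /G /=.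
  have kr : (k <= r)%N by apply: ltnW.
  (* The pointers up to z_k read only layer ordinals below [k], hence never the slot [(b, (k, u))]
     itself. *)
  have path_eq j : (j <= k)%N -> path w j = path w' j.
    elim: j => // j IH jk /=; rewrite IH ?(ltnW jk) // /next off //.
    rewrite !xpair_eqE negb_and; apply/orP; right; rewrite negb_and; apply/orP; left.
    apply/eqP => /(congr1 val); rewrite /= inordK ?(leq_trans jk) // => jk'.
    by move: jk; rewrite jk' ltnn.
  congr pair; first by rewrite -!(take_run _ _ kr); congr take; exact: e.
  by apply/eq_in_map => j; rewrite mem_iota add0n => /ltnW; exact: path_eq.
have -> : \sum_(0 <= j < r) \sum_u dev R (state j) (next j u) =
    \sum_(i | P i) dev R (G i) (fun w : W => w.1.1 i).
  rewrite big_mkord [RHS]big_mkcond /=.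
  rewrite [RHS](eq_bigr (fun i : I => if P (i.1, i.2)
    then dev R (G (i.1, i.2)) (fun w : W => w.1.1 (i.1, i.2)) else 0)); last by case.
  rewrite -[RHS](pair_bigA _ (fun b ju => if P (b, ju)
    then dev R (G (b, ju)) (fun w : W => w.1.1 (b, ju)) else 0)) /=.
  rewrite [RHS]exchange_big /= pair_bigA /=; apply: eq_bigr => -[k u] _ /=.
  rewrite (bigD1 (odd k)) //= /P /= eqxx big1 ?addr0 => [|b /negbTE -> //].
  by congr (dev R); apply/funext => w; rewrite /next inord_val.
apply: (@le_trans _ _ (2 / m%:R * (4 / m%:R * \sum_(i | P i) H i))).
  rewrite ler_wpM2l ?divr_ge0 // mulr_sumr; apply: ler_sum => i _.
  exact: dev_le_hel.
have -> : 2 / m%:R * (4 / m%:R * \sum_(i | P i) H i) = (8 / m%:R ^+ 2) * \sum_(i | P i) H i.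
  by field; rewrite pnatr_eq0.
have -> : 4096 * n.+1%:R * #|{: W}|%:R / m%:R ^+ 2 =
   (8 / m%:R ^+ 2) * (512 * n.+1%:R * #|{: W}|%:R) :> R.
  move: (#|{: W}|%:R : R) (n.+1%:R : R) (m%:R : R) m0 => N k M M0.
  by field; rewrite gt_eqF.
by rewrite ler_wpM2l // divr_ge0 // exprn_ge0.
Qed.

Lemma sum_parity (b : bool) (l : nat) :
  (\sum_(z < l) (odd z.+1 == b) = if b then uphalf l else l./2)%N.
Proof.
elim: l => [|l IH]; first by rewrite big_ord0; case: b.
rewrite big_ord_recr /= IH /= uphalf_half; case: b {IH}; case: (odd l) => /=; lia.
Qed.

(** The output is read off the history, so it is a guess of the parity of z_r given the state. At
    most [(m + 1) / 2] indices have a given parity, whence the term [(2 * m)^-1]; the last term is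
    [dev_final] divided by [4 * eps]. *)
Theorem success_le (eps : R) : 0 < eps ->
  \sum_w (BMHPC (hard w) == Some (output s (hard w)))%:R <=
  #|{: W}|%:R * (2^-1 + (2 * m%:R)^-1 + eps + 1024 * n.+1%:R / (eps * m%:R ^+ 2)).
Proof.
move=> e0; have m0 : 0 < m%:R :> R by rewrite ltr0n.
pose o (w : W) : pred 'I_m := fun z => odd z.+1 == output s (hard w).
have -> : \sum_w (BMHPC (hard w) == Some (output s (hard w)))%:R =
    \sum_w (o w (path w r))%:R :> R.
  by apply: eq_bigr => w _; rewrite /BMHPC pointer_hard.
have oG w w' : state r w = state r w' -> o w = o w'.
  move=> e; have er : run s (hard w) = run s (hard w').
    exact: (congr1 (fun p : history * seq 'I_m => p.1) e).
  by apply/funext => z; rewrite /o /output er.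
have oN w : \sum_(z | o w z) 1 <= (m.+1)%:R / 2 :> R.
  rewrite ler_pdivlMr // (_ : \sum_(z | o w z) 1 = (\sum_(z < m) (odd z.+1 == output s (hard w)))%:R).
    rewrite sum_parity -natrM ler_nat; case: ifP => _; have := odd_double_half m;
    rewrite ?uphalf_half; case: (odd m) => /=; lia.
  by rewrite natr_sum big_mkcond; apply: eq_bigr => z _; rewrite /o; case: (_ == _).
apply: le_trans (guess_le (ltn0Sn m') (fun w => path w r) e0 oG oN) _.
have := dev_final.
set D := dev R _ _ => HD.
have -> : #|{: W}|%:R * (2^-1 + (2 * m%:R)^-1 + eps + 1024 * n.+1%:R / (eps * m%:R ^+ 2)) =
   #|{: W}|%:R * ((m.+1)%:R / 2 / m%:R + eps) +
   (4 * eps)^-1 * (4096 * n.+1%:R * #|{: W}|%:R / m%:R ^+ 2).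
  rewrite -[m.+1%:R]natr1.
  move: (#|{: W}|%:R : R) (n.+1%:R : R) (m%:R : R) m0 => N k M M0.
  by field; rewrite !gt_eqF.
by rewrite lerD2l ler_wpM2l // invr_ge0 mulr_ge0 // ltW.
Qed.

End HardDistribution.

(** * Averaging over the public coins, and the choice of constants *)

Lemma sum_probability_le (R : realType) (d : measure_display) (T : measurableType d)
  (P : probability T R) (A : finType) (C : A -> set T) (M : R) :
  (forall a, measurable (C a)) ->
  (forall w, \sum_a \1_(C a) w <= M) ->
  (\sum_a P (C a) <= M%:E)%E.
Proof.
move=> mC CM.
have -> : (\sum_a P (C a) = \int[P]_(w in setT) (\sum_a (\1_(C a) w)%:E))%E.
  rewrite ge0_integral_sum //.
  - by apply: eq_bigr => a _; rewrite integral_indic // setIT.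
  - by move=> a; apply/measurable_EFinP; exact: measurable_indic.
have -> : M%:E = (\int[P]_(w in setT) cst M%:E w)%E.
  by rewrite integral_cst // -[LHS]mule1; congr (_ * _)%E; exact/esym/(@probability_setT _ _ _ P).
apply: ge0_le_integral => //.
- by move=> w _; apply: sume_ge0 => a _; rewrite lee_fin.
- by apply: emeasurable_sum => a; apply/measurable_EFinP; exact: measurable_indic.
- by move=> w _; rewrite sumEFin lee_fin.
Qed.

Theorem theorem4p1 (R : realType) (q : R) (hq : 2^-1 < q) :
  exists2 c : R, 0 < c &
  exists m0 : nat, forall m r : nat, (m0 <= m)%N -> (1 <= r)%N ->
  forall (d : measure_display) (T : measurableType d) (P : probability T R)
         (p : T -> protocol m r),
    (forall w : T, misaligned (p w)) ->
    solves P p q ->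
    forall n : nat, cost_at_most p n -> c * m%:R ^+ 2 <= n%:R.
Proof.
pose D := q - 2^-1; have D0 : 0 < D by rewrite subr_gt0.
(* With [eps = D / 4], the bound [n + 1 <= 2 * c * m ^+ 2] keeps the last term of [success_le] at
   most [D / 4]. *)
pose c := D ^+ 2 / (128 * 256).
have c0 : 0 < c by rewrite divr_gt0 ?exprn_gt0.
(* [4 / D] makes [(2 * m)^-1] smaller than [D / 4]; [c^-1] gives [1 <= c * m ^+ 2], which absorbs
   the 1 in [n + 1]. The three errors then add up to less than [D]. *)
exists c => //; exists (Num.bound (4 / D + c^-1)).+1.
move=> [|m'] [|r'] // m0 _ d T P p mis sol n cost.
set m := m'.+1 in p mis sol cost *; set r := r'.+1 in p mis sol cost *.
rewrite leNgt; apply/negP => small.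
have mb : 4 / D + c^-1 < m%:R.
  apply: lt_le_trans (archi_boundP _) _; first by rewrite addr_ge0 ?divr_ge0 ?invr_ge0 // ltW.
  by rewrite ler_nat; exact: leq_trans m0.
have Di : 0 < 4 / D by rewrite divr_gt0.
have ci : 0 < c^-1 by rewrite invr_gt0.
have m1 : 1 <= m%:R :> R by rewrite ler1n.
have m_gt0 : 0 < m%:R :> R by lra.
pose W := ({ffun bool * ('I_r * 'I_m) -> 'I_m} *
  {ffun (bool * ('I_r * 'I_m)) * 'I_m -> bool} *
  {ffun (bool * ('I_r * 'I_m)) * 'I_m -> bool})%type.
pose C (x : W) : set T := [set w | BMHPC (hard x) = Some (output (p w) (hard x))]%classic.
have W0 : 0 < #|{: W}|%:R :> R.
  by rewrite ltr0n; apply/card_gt0P; exists ([ffun=> ord0], [ffun=> true], [ffun=> true]).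
pose M := #|{: W}|%:R * (2^-1 + (2 * m%:R)^-1 + D / 4 + 1024 * n.+1%:R / (D / 4 * m%:R ^+ 2)).
(* For each outcome of the coins the protocol is deterministic, so [success_le] bounds its successes
   over the hard inputs; integrating over the coins keeps the bound. *)
have : (\sum_(x : W) P (C x) <= M%:E)%E.
  apply: sum_probability_le => [x|w]; first by case: (sol _ (hard_promise x)).
  have := @success_le R m' r' (p w) (mis w) n (@strat_self_delimiting _ _ (p w)) (cost w) (D / 4) _.
  move=> /(_ ltac:(by rewrite divr_gt0)); apply: le_trans.
  apply: ler_sum => x _; rewrite indicE.
  rewrite (_ : w \in C x = (BMHPC (hard x) == Some (output (p w) (hard x)))) //.
  by apply/idP/eqP; rewrite inE.
have : ((#|{: W}|%:R * q)%:E <= \sum_(x : W) P (C x))%E.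
  rewrite mulr_natl -(sumr_const xpredT q) -sumEFin; apply: lee_sum => x _.
  by case: (sol _ (hard_promise x)).
move=> /le_trans H /H{H}; rewrite lee_fin /M ler_pM2l // leNgt => /negP; apply.
have h1 : (2 * m%:R)^-1 < D / 4.
  rewrite invf_plt ?posrE ?mulr_gt0 ?divr_gt0 // invf_div; lra.
have h2 : 1024 * n.+1%:R / (D / 4 * m%:R ^+ 2) <= D / 4.
  rewrite ler_pdivrMr; last by rewrite !mulr_gt0 ?exprn_gt0.
  have : 1 <= c * m%:R ^+ 2.
    rewrite -ler_pdivrMl // mulr1 expr2; nra.
  rewrite -natr1 => h; have : n%:R + 1 <= 2 * (c * m%:R ^+ 2) :> R by lra.
  by rewrite /c; lra.
rewrite /D in h1 h2 *; lra.
Qed.
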